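(* Let $n\ge 1$ and let $p,q\in\mathbb{Q}\setminus\{0\}$ be such that $\frac1p+\frac1q=1$. Then the generalised power sum hypersurfaces in $\mathbb{P}^n$ satisfy $$V(\mathfrak{f}_p)^* = V(\mathfrak{f}_q).$$
   Context: We work over $\mathbb{C}$, and polynomials in $\mathbb{C}[x_0,\ldots,x_n]$ are considered up to non-zero scalars. Coordinate-wise powers: for $r\in\mathbb{Z}\setminus\{0\}$ let $\varphi_r\colon\mathbb{P}^n\dashrightarrow\mathbb{P}^n$, $[x_0:\ldots:x_n]\mapsto[x_0^r:\ldots:x_n^r]$. For a variety $X\subset\mathbb{P}^n$ put $X^{\circ r}:=\varphi_r(X)$ if $r>0$, and $X^{\circ r}:=\overline{\varphi_r(X\setminus V(x_0x_1\cdots x_n))}$ if $r<0$ (for $r<0$ only varieties with no irreducible component contained in a coordinate hyperplane are considered). Power sums: for a positive integer $s$ let $\mathfrak{f}_s:=x_0^s+\ldots+x_n^s$ and $\mathfrak{f}_{-s}:=\sum_{i=0}^n\prod_{j\ne i}x_j^s$, and let $\mathfrak{f}_0:=1$. For $s\in\mathbb{Z}\setminus\{0\}$ and $r\in\mathbb{Z}\setminus\{0\}$ let $\mathfrak{f}_s^{\circ r}$ be the square-free defining polynomial (up to scaling) of the hypersurface $V(\mathfrak{f}_s)^{\circ r}\subset\mathbb{P}^n$, and $\mathfrak{f}_0^{\circ r}:=1$. For a rational number $p=\frac sr$ ($s,r\in\mathbb{Z}$, $r\ne0$) the generalised power sum polynomial is $\mathfrak{f}_p:=\mathfrak{f}_s^{\circ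 r}$; this does not depend on the choice of $s,r$. Dual variety: for a hypersurface $V(f)\subset\mathbb{P}^n$, the dual variety $V(f)^*$ is the Zariski closure in $(\mathbb{P}^n)^*$ of the set of hyperplanes that arise as the projective tangent space at a smooth point of $V(f)$; $(\mathbb{P}^n)^*$ is identified with $\mathbb{P}^n$ via the standard bilinear form on $\mathbb{C}^{n+1}$. *)

(* Defs.v *)
Set Warnings "-notation-overridden,-ambiguous-paths,-notation-incompatible-prefix".
From mathcomp Require Import all_boot all_order all_algebra.
From mathcomp Require Import classical_sets reals.
From mathcomp Require Import complex mpoly.
Set Implicit Arguments.
Unset Strict Implicit.
Unset Printing Implicit Defensive.
Import GRing.Theory Num.Theory.
Local Open Scope ring_scope.
Local Open Scope classical_set_scope.

(* A subset of P^n is represented by the set of all its homogeneous coordinate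
   vectors: a set of nonzero vectors of F^(n+1), stable under nonzero scaling.
   For homogeneous polynomials all the sets below are of this kind, and equality
   of such sets is equality of subsets of P^n. *)

Section ProjectiveHypersurfaces.
Variables (F : closedFieldType) (n : nat).
Implicit Types (f g h : {mpoly F[n.+1]}) (X : set 'rV[F]_n.+1).
Implicit Types (x y a : 'rV[F]_n.+1).

Definition proj_zeros f : set 'rV[F]_n.+1 :=
  [set x : 'rV[F]_n.+1 | x != 0 /\ f.@[x 0] = 0].

Definition zariski_closure X : set 'rV[F]_n.+1 :=
  [set x : 'rV[F]_n.+1 | x != 0 /\
    forall (d : nat) g, g \is d.-homog ->
      (forall y, X y -> g.@[y 0] = 0) -> g.@[x 0] = 0].

(* The case f = 0 is excluded, since 0 = 0 ^+ 2 * 0 and 0 is not a unit. *)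
Definition squarefree f : Prop :=
  forall g h, f = g ^+ 2 * h -> g \is a GRing.unit.

(* f is a square-free defining polynomial of X; it is determined by X up to a
   nonzero scalar. *)
Definition reduced_equation f X : Prop :=
  [/\ exists d : nat, f \is d.-homog, squarefree f & proj_zeros f = X].

(* Scaling by c gives all the homogeneous coordinate vectors of the image
   points. *)
Definition coord_power_image (r : int) X : set 'rV[F]_n.+1 :=
  [set y : 'rV[F]_n.+1 | exists (x : 'rV[F]_n.+1) (c : F),
    [/\ X x, c != 0 & y = c *: (\row_i (x 0 i ^ r))]].

Definition coord_hyperplanes : set 'rV[F]_n.+1 :=
  proj_zeros (\prod_(i < n.+1) 'X_i).

(* Only meaningful for r != 0. *)
Definition coord_power (r : int) X : set 'rV[F]_n.+1 :=
  if 0 < r then coord_power_image r X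
  else zariski_closure (coord_power_image r (X `\` coord_hyperplanes)).

(* Negz m is the integer - m.+1. *)
Definition power_sum (s : int) : {mpoly F[n.+1]} :=
  match s with
  | Posz 0 => 1
  | Posz m => \sum_(i < n.+1) 'X_i ^+ m
  | Negz m => \sum_(i < n.+1) \prod_(j < n.+1 | j != i) 'X_j ^+ m.+1
  end.

(* Polynomials being considered up to nonzero scalars, "f is the coordinate-wise
   r-th power of the s-th power sum" is a relation. *)
Definition is_power_sum_power (s r : int) f : Prop :=
  if s == 0 then exists2 c : F, c != 0 & f = c *: 1
  else reduced_equation f (coord_power r (proj_zeros (power_sum s))).

Definition is_gen_power_sum (p : rat) f : Prop :=
  exists s r : int,
    [/\ r != 0, p = s%:~R / r%:~R & is_power_sum_power s r f].

(* The identification of (P^n)^* with P^n by the standard bilinear form. *)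
Definition hyperplane a : set 'rV[F]_n.+1 :=
  [set y : 'rV[F]_n.+1 | y != 0 /\ \sum_(i < n.+1) a 0 i * y 0 i = 0].

Definition gradient f x : 'rV[F]_n.+1 :=
  \row_(i < n.+1) (f^`M(i)).@[x 0].

(* Smoothness and tangent spaces of a hypersurface are read off its square-free
   equation f. *)
Definition smooth_point f x : Prop :=
  proj_zeros f x /\ gradient f x != 0.

Definition proj_tangent_space f x : set 'rV[F]_n.+1 :=
  [set y : 'rV[F]_n.+1 | y != 0 /\ \sum_(i < n.+1) (f^`M(i)).@[x 0] * y 0 i = 0].

Definition dual_variety X : set 'rV[F]_n.+1 :=
  zariski_closure
    [set a : 'rV[F]_n.+1 | a != 0 /\ exists f (x : 'rV[F]_n.+1),
      [/\ reduced_equation f X, smooth_point f x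
        & hyperplane a = proj_tangent_space f x]].

End ProjectiveHypersurfaces.

(* Main.v *)
(* With z ranging over the points of the torus with sum_i z_i^s = 0, the hypersurface
   V(f_(s/r)) is the closure of the set of the points z^r; we may take r > 0. The
   tangent hyperplane at z^r is z^(s-r) up to scaling, because a polynomial vanishing
   on all the z^r vanishes to second order along the tangent directions of the power
   sum hypersurface. As q = s / (s - r), this sends V(f_p) to V(f_q): the polynomial
   f_q(grad f) vanishes at all the z^r, hence on V(f_p), which gives V(f_p)^* in V(f_q).
   For the converse we need many z such that z^r is a smooth point. The polynomial ring
   is factorial, so by Gauss's lemma a square-free f_p is separable in its last
   variable; the last partial derivative can thus only vanish on V(f_p) where some
   nonzero polynomial c in the other coordinates does. The z with c(z^r) != 0 are
   dense in the power sum hypersurface, since one can solve sum_i z_i^s = 0 for the last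
   coordinate over every line in the space of the other coordinates. *)
From HB Require Import structures.
Require Import Defs.
From mathcomp Require Import all_boot all_order all_algebra.
From mathcomp Require Import separable.
From mathcomp Require Import boolp classical_sets reals.
From mathcomp Require Import complex mpoly.
From mathcomp Require Import ring zify.
Set Implicit Arguments.
Unset Strict Implicit.
Unset Printing Implicit Defensive.
Import GRing.Theory Num.Theory.
Local Open Scope ring_scope.

(** * Gauss's lemma and square-free polynomials *)

Definition dvdr (A : idomainType) (a b : A) := exists c, b = a * c.

Definition prime_elt (A : idomainType) (p : A) :=
  [/\ p != 0, p \isn't a GRing.unit
    & forall a b, dvdr p (a * b) -> dvdr p a \/ dvdr p b].

Definition irreducible_elt (A : idomainType) (p : A) :=
  [/\ p != 0, p \isn't a GRing.unit
    & forall a b, p = a * b -> a \is a GRing.unit \/ b \is a GRing.unit].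

Inductive prime_product (A : idomainType) : A -> Prop :=
| PrimeProductUnit u : u \is a GRing.unit -> prime_product u
| PrimeProductCons p a : prime_elt p -> prime_product a -> prime_product (p * a).

(** A factorisation into primes is automatically unique up to units and order, so asking for its
    existence is enough. *)
Definition factorial_domain (A : idomainType) := forall a : A, a != 0 -> prime_product a.

Lemma prime_productM (A : idomainType) (a b : A) :
  prime_product a -> prime_product b -> prime_product (a * b).
Proof.
elim=> [u Uu|p c pp _ IH] pb; last by rewrite -mulrA; apply: PrimeProductCons (IH pb).
case: pb => [v Uv|p c [p0 pN pp] pc]; first by apply: PrimeProductUnit; rewrite unitrM Uu.
(* A unit in front of a product of primes is absorbed into the first prime: [u * p] is again
   prime. *)
rewrite mulrA; apply: PrimeProductCons pc; split.
- by rewrite mulf_neq0 //; apply: contraTneq Uu => ->; rewrite unitr0.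
- by rewrite unitrM (negbTE pN) andbF.
have dvdu x : dvdr (u * p) x <-> dvdr p x.
  split=> -[y ->]; first by exists (u * y); rewrite mulrCA mulrA.
  by exists (u^-1 * y); rewrite mulrACA mulrV // mul1r.
by move=> a' b' /dvdu /pp [] /dvdu; [left | right].
Qed.

Section Factorial.
Variable R : idomainType.
Implicit Types (a b c p u : R).

Lemma prime_polyC p : prime_elt p -> prime_elt p%:P.
Proof.
move=> [p0 pN pp]; split; first by rewrite polyC_eq0.
  by rewrite poly_unitE coefC size_polyC p0.
suff H N (f g : {poly R}) : (size f + size g <= N)%N ->
    dvdr p%:P (f * g) -> dvdr p%:P f \/ dvdr p%:P g by move=> f g; apply: H.
elim: N f g => [|N IH] f g.
  rewrite leqn0 addn_eq0 !size_poly_eq0 => /andP[/eqP-> _] _; left.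
  by exists 0; rewrite mulr0.
have [-> _ _|f0] := eqVneq f 0; first by left; exists 0; rewrite mulr0.
have [-> _ _|g0] := eqVneq g 0; first by right; exists 0; rewrite mulr0.
move=> szfg [h Hh].
have cut (k : {poly R}) : k != 0 -> dvdr p (lead_coef k) ->
    exists k' l, k = k' + p%:P * l /\ (size k' < size k)%N.
  move=> k0 [c Hc]; exists (k - lead_coef k *: 'X^((size k).-1)), (c *: 'X^((size k).-1)).
  rewrite mul_polyC scalerA -Hc addrNK; split=> //.
  have szk: (0 < size k)%N by rewrite size_poly_gt0.
  rewrite -[ltnRHS]prednK // ltnS; apply/leq_sizeP => j.
  rewrite leq_eqVlt coefB coefZ coefXn => /predU1P [<-|ltj].
    by rewrite eqxx mulr1 subrr.
  by rewrite gtn_eqF // mulr0 subr0 nth_default // -(prednK szk).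
have dl: dvdr p (lead_coef f * lead_coef g).
  by exists (lead_coef h); rewrite -lead_coefM Hh lead_coefM lead_coefC.
case/pp: dl => /cut [] // k [l [Hk szk]].
- have [||[m Hm]|] := IH k g.
  + by rewrite -ltnS (leq_trans _ szfg) // ltn_add2r.
  + by exists (h - l * g); rewrite mulrBr -Hh Hk; ring.
  + by left; exists (m + l); rewrite Hk Hm mulrDr.
  + by right.
- have [|||[m Hm]] := IH f k.
  + by rewrite -ltnS (leq_trans _ szfg) // ltn_add2l.
  + by exists (h - f * l); rewrite mulrBr -Hh Hk; ring.
  + by left.
  + by right; exists (m + l); rewrite Hk Hm mulrDr.
Qed.

(** The prime factors of [c] stay prime as constant polynomials, so each divides [g] or [h] and is
    cancelled there; [a] and [b] collect what is taken from each side. *)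
Lemma polyC_split c (f g h : {poly R}) : prime_product c -> c%:P * f = g * h ->
  exists g' h' a b, [/\ f = g' * h', g = a%:P * g' & h = b%:P * h'].
Proof.
move=> pc; elim: pc f g h => {c} [u Uu|p c pp _ IH] f g h.
  move=> E; exists (u^-1%:P * g), h, u, 1; rewrite !mulrA -polyCM mulrV // !mul1r.
  by rewrite -mulrA -E mulrA -polyCM mulVr // mul1r.
have [p0 _ pp'] := prime_polyC pp; rewrite polyCM -mulrA => E.
have : dvdr p%:P (g * h) by exists (c%:P * f).
case/pp' => -[k Hk].
  have /IH [g' [h' [a [b [fE kE lE]]]]] : c%:P * f = k * h.
    by apply: (mulfI p0); rewrite E Hk mulrA.
  by exists g', h', (p * a), b; split; rewrite // Hk kE polyCM mulrA.
have /IH [g' [h' [a [b [fE kE lE]]]]] : c%:P * f = g * k.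
  by apply: (mulfI p0); rewrite E Hk; ring.
by exists g', h', a, (p * b); split; rewrite // Hk lE polyCM mulrA.
Qed.

Lemma polyC_square_split c (f g h : {poly R}) :
    prime_product c -> c%:P * f = g ^+ 2 * h ->
  exists g' h', f = g' ^+ 2 * h' /\ size g' = size g.
Proof.
move=> pc; elim: pc f g h => {c} [u Uu|p c pp _ IH] f g h.
  move=> E; exists g, (u^-1%:P * h); split=> //.
  by rewrite mulrCA -E mulrA -polyCM mulVr // mul1r.
have [p0 _ pp'] := prime_polyC pp; rewrite polyCM -mulrA => E.
have : dvdr p%:P (g * (g * h)) by exists (c%:P * f); rewrite E mulrA.
(* If [p] divides [g], the right side contains [p] twice; one copy is cancelled and the other moves
   into [h], so [g] loses only a constant and keeps its size. *)
have fromg : dvdr p%:P g -> exists g' h', f = g' ^+ 2 * h' /\ size g' = size g.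
  case=> k Hk; have /IH [g' [h' [-> sz]]] : c%:P * f = k ^+ 2 * (p%:P * h).
    by apply: (mulfI p0); rewrite E Hk; ring.
  by exists g', h'; rewrite Hk mul_polyC size_scale // -polyC_eq0.
case/pp' => // /pp' [|[k Hk]] //.
by apply: (IH _ _ k); apply: (mulfI p0); rewrite E Hk; ring.
Qed.

Hypothesis factR : factorial_domain R.

(* Gauss's lemma, with pseudo-divisibility [%|] in place of divisibility over the
   fraction field. *)
Lemma irreducible_prime (f : {poly R}) : irreducible_elt f -> prime_elt f.
Proof.
move=> [f0 fN firr]; split=> //.
have [sf|sf] := leqP (size f) 1.
  have [c fE] : exists c, f = c%:P by exists f`_0; apply: size1_polyC.
  have c0 : c != 0 by rewrite -polyC_eq0 -fE.
  case: (factR c0) fE => [u Uu|p a pp _] fE.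
    by case/negP: fN; rewrite fE poly_unitE coefC size_polyC Uu andbT -polyC_eq0 -fE f0.
  have [p0 pN pp'] := prime_polyC pp.
  have [||Ua] := firr p%:P a%:P; rewrite ?fE ?polyCM ?(negbTE pN) //.
  have dvdu x : dvdr (p%:P * a%:P) x <-> dvdr p%:P x.
    split=> -[y ->]; first by exists (a%:P * y); rewrite mulrA.
    by exists (a%:P^-1 * y); rewrite -mulrA (mulrA a%:P) mulrV // mul1r.
  by move=> g h /dvdu /pp' [] /dvdu; [left|right].
(* Nonzero constants can be cancelled from a divisibility by [f]: a constant factor [a] of [f] is a
   unit, since [f] is irreducible of positive degree. *)
have primf c (g h : {poly R}) : c != 0 -> c%:P * g = f * h -> dvdr f g.
  move=> c0 /(polyC_split (factR c0)) [f' [h' [a [b [gE fE _]]]]].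
  have a0 : a != 0 by apply: contraNneq f0 => a0; rewrite fE a0 mul0r.
  have [/unitrP [a' [Ha _]]|Uf'] := firr _ _ fE.
    by exists (a' * h'); rewrite gE fE -[f' in LHS]mul1r -Ha; ring.
  move: Uf'; rewrite poly_unitE => /andP[/eqP sz1 _]; move: sf.
  by rewrite fE mul_polyC size_scale // sz1.
move=> g h [k E].
have [cop|ncop] := boolP (coprimep f g).
  (* With denominators cleared, the Bezout relation has a nonzero constant [c] on its right side;
     multiplying it by [h] shows that [f] divides [c * h]. *)
  right; have /Bezout_coprimepP [[u v] /= /eqp_size] := cop.
  rewrite size_poly1 => /eqP/size_poly1P [c c0 Ec].
  apply: (primf c _ (u * h + v * k)) => //.
  by rewrite -Ec mulrDl -(mulrA v) E; ring.
(* [d] is nonconstant and divides [f] up to constants, so by irreducibility [f] is a unit times the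
   factor [d'] of [d]; as [d] divides [g] up to constants, so does [f]. *)
left; set d := gcdp f g.
have d0 : d != 0 by rewrite gcdp_eq0 (negbTE f0).
have sd : (1 < size d)%N.
  by rewrite ltn_neqAle eq_sym size_poly_gt0 d0 andbT -coprimep_def.
have /Pdiv.Idomain.dvdpP [[c e] /= c0] := dvdp_gcdl f g.
rewrite -mul_polyC -/d => /(polyC_split (factR c0)) [e' [d' [a [b [fE _ dE]]]]].
have b0 : b != 0 by apply: contraNneq d0 => b0; rewrite dE b0 mul0r.
have [Ue|Ud] := firr _ _ fE; last first.
  move: Ud; rewrite poly_unitE => /andP[/eqP sz1 _]; move: sd.
  by rewrite dE mul_polyC size_scale // sz1.
have /Pdiv.Idomain.dvdpP [[c' l] /= c'0] := dvdp_gcdr f g.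
rewrite -mul_polyC -/d => gE.
apply: (primf c' _ (e'^-1 * (l * b%:P))) => //.
by rewrite gE dE fE mulrACA mulrV // mul1r; ring.
Qed.

(** If [u * v] divides [f], the square of [d = gcdp u v] divides [f] up to a constant;
    [polyC_square_split] removes the constant without changing the size of [d], which must then be
    1. The remaining condition on derivatives holds in characteristic 0. *)
Lemma squarefree_separable (f : {poly R}) : [pchar R] =i pred0 -> f != 0 ->
    (forall g h, f = g ^+ 2 * h -> g \is a GRing.unit) -> separable_poly f.
Proof.
move=> ch0 f0 sqf; apply/separable_polyP; split=> [u v uvf|u _ su].
  apply: contraT => ncop; set d := gcdp u v.
  have /Pdiv.Idomain.dvdpP [[c e] /= c0] : d * d %| f.
    by apply: dvdp_trans uvf; apply: dvdp_mul; rewrite (dvdp_gcdl, dvdp_gcdr).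
  move=> E; have [g [h [fE sg]]] : exists g h, f = g ^+ 2 * h /\ size g = size d.
    by apply: (polyC_square_split (factR c0) (h := e)); rewrite mul_polyC E; ring.
  have := sqf _ _ fE; rewrite poly_unitE sg => /andP[/eqP sd _].
  by rewrite coprimep_def sd in ncop.
have szu : (0 < (size u).-1)%N by rewrite -subn1 subn_gt0.
apply/eqP => /polyP /(_ (size u).-2); rewrite coef_deriv coef0 prednK //.
move/eqP; rewrite -mulr_natr mulf_eq0 (GRing.pcharf0P R).1 //.
by rewrite -lead_coefE lead_coef_eq0 -size_poly_eq0; case: (size u) szu su => [|[]].
Qed.

End Factorial.

Lemma prime_elt_iso (A B : idomainType) (phi : {rmorphism A -> B})
    (psi : {rmorphism B -> A}) (a : A) :
  cancel phi psi -> cancel psi phi -> prime_elt (phi a) -> prime_elt a.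
Proof.
move=> phiK psiK [a0 aN pa]; split.
- by apply: contraNneq a0 => ->; rewrite rmorph0.
- by apply: contraNN aN; apply: rmorph_unit.
move=> b c [d E]; have : dvdr (phi a) (phi b * phi c).
  by exists (phi d); rewrite -!rmorphM E.
case/pa => -[e He]; [left|right]; exists (psi e); apply: (can_inj phiK);
  by rewrite rmorphM psiK.
Qed.

Lemma irreducible_elt_iso (A B : idomainType) (phi : {rmorphism A -> B})
    (psi : {rmorphism B -> A}) (a : A) :
  cancel phi psi -> cancel psi phi -> irreducible_elt a -> irreducible_elt (phi a).
Proof.
move=> phiK psiK [a0 aN ia]; split.
- by apply: contraNneq a0 => E; rewrite -[a]phiK E rmorph0.
- by apply: contraNN aN => U; rewrite -[a]phiK; apply: rmorph_unit.
move=> b c E; have : a = psi b * psi c by rewrite -rmorphM -E phiK.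
by case/ia => U; [left; rewrite -[b]psiK | right; rewrite -[c]psiK]; apply: rmorph_unit.
Qed.

Lemma mpoly_closed_ind (n : nat) (R : nzRingType) (P : {mpoly R[n]} -> Prop) :
    (forall c, P c%:MP) -> (forall i, P 'X_i) ->
    (forall p q, P p -> P q -> P (p + q)) -> (forall p q, P p -> P q -> P (p * q)) ->
  forall p, P p.
Proof.
move=> PC PX PD PM p; rewrite (mpolyE p).
elim/big_ind: _ => [|p' q'|m _]; [by rewrite -mpolyC0 | exact: PD |].
rewrite -mul_mpolyC; apply: (PM) => //; rewrite mpolyXE_id.
elim/big_ind: _ => [|p' q'|i _]; [by rewrite -mpolyC1 | exact: PM |].
by elim: (m i) => [|k IH]; rewrite ?expr0 -?mpolyC1 // exprS; apply: (PM).
Qed.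

Lemma mpoly_rmorph_ext (n : nat) (R A : nzRingType) (f g : {rmorphism {mpoly R[n]} -> A}) :
  (forall c, f c%:MP = g c%:MP) -> (forall i, f 'X_i = g 'X_i) -> f =1 g.
Proof.
move=> eqC eqX; elim/mpoly_closed_ind => // p q IHp IHq.
  by rewrite !rmorphD IHp IHq.
by rewrite !rmorphM IHp IHq.
Qed.

(** * Multivariate polynomials as univariate polynomials in the last variable *)

Section Univariate.
Variables (R : comNzRingType) (n : nat).
Implicit Types (p : {mpoly R[n.+1]}) (q : {poly {mpoly R[n]}}).

Local Notation widen := (widen_ord (leqnSn n)).

Lemma muniXU_widen (i : 'I_n) : muni 'X_(widen i) = ('X_i)%:P :> {poly {mpoly R[n]}}.
Proof.
rewrite muniE msuppX big_seq1 mcoeffX eqxx scale1r mnm1E.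
have -> : (widen i == ord_max) = false by apply/eqP=> /(congr1 val) /= /eqP; rewrite ltn_eqF.
rewrite expr0 -[RHS]mulr1 mul_polyC; congr ('X_[_] *: _).
by apply/mnmP=> j; rewrite mnmE !mnm1E.
Qed.

Lemma muniXU_max : muni 'X_ord_max = 'X :> {poly {mpoly R[n]}}.
Proof.
rewrite muniE msuppX big_seq1 mcoeffX eqxx scale1r mnm1E eqxx expr1.
rewrite -[RHS]scale1r -mpolyX0; congr ('X_[_] *: _).
apply/mnmP=> j; rewrite mnmE mnm1E mnm0E; case: eqP => //.
by move=> /(congr1 val) /= /eqP; rewrite gtn_eqF.
Qed.

Lemma ord_widenP (i : 'I_n.+1) : i = ord_max \/ exists j, i = widen j.
Proof.
have := ltn_ord i; rewrite ltnS leq_eqVlt => /predU1P [E|lti].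
  by left; apply: val_inj.
by right; exists (Ordinal lti); apply: val_inj.
Qed.

(** The inverse of [muni]; the resulting ring isomorphism transports primality and irreducibility
    between the two polynomial rings. *)
Definition unmuni : {poly {mpoly R[n]}} -> {mpoly R[n.+1]} :=
  horner_eval 'X_ord_max \o map_poly (@mwiden n R).
HB.instance Definition _ := GRing.RMorphism.on unmuni.

Lemma muniK : cancel (@muni n R) unmuni.
Proof.
apply: (mpoly_rmorph_ext (f := unmuni \o @muni n R) (g := idfun)) => [c|i] /=.
  by rewrite muniC /unmuni /= /horner_eval map_polyC hornerC /= mwidenC.
have [->|[j ->]] := ord_widenP i.
  by rewrite muniXU_max /unmuni /= /horner_eval map_polyX hornerX.
by rewrite muniXU_widen /unmuni /= /horner_eval map_polyC hornerC /= mwidenX mnmwiden1.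
Qed.

Lemma muni_mwiden (p : {mpoly R[n]}) : muni (mwiden p) = p%:P.
Proof.
apply: (mpoly_rmorph_ext (f := @muni n R \o @mwiden n R) (g := polyC)) => [c|i] /=.
  by rewrite mwidenC muniC.
by rewrite mwidenX mnmwiden1 muniXU_widen.
Qed.

Lemma unmuniK : cancel unmuni (@muni n R).
Proof.
move=> q; elim/poly_ind: q => [|q c IH]; first by rewrite !rmorph0.
rewrite rmorphD rmorphM muniD muniM IH.
congr (_ * _ + _); rewrite /= /unmuni /= /horner_eval.
  by rewrite map_polyX hornerX muniXU_max.
by rewrite map_polyC hornerC /= muni_mwiden.
Qed.

Lemma meval_muni p (v : 'I_n.+1 -> R) :
  p.@[v] = (map_poly (meval (v \o widen)) (muni p)).[v ord_max].
Proof.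
apply: (mpoly_rmorph_ext (f := meval v)
  (g := horner_eval (v ord_max) \o map_poly (meval (v \o widen)) \o @muni n R)) => [c|i] /=.
  by rewrite muniC mevalC /= /horner_eval map_polyC /= hornerC mevalC.
have [->|[j ->]] := ord_widenP i.
  by rewrite muniXU_max /= /horner_eval map_polyX hornerX mevalXU.
by rewrite muniXU_widen /= /horner_eval map_polyC hornerC /= !mevalXU.
Qed.

Lemma muni_deriv p : muni p^`M(ord_max) = (muni p)^`().
Proof.
elim/mpolyind: p => [|c m p _ _ IH]; first by rewrite mderiv0 muni0 deriv0.
rewrite mderivD !muniD derivD IH; congr (_ + _).
rewrite mderivZ mderivX scaler_nat !muniZ muniMn derivZ; congr (_ *: _).
rewrite !muniE !msuppX !big_seq1 !mcoeffX !eqxx !scale1r.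
rewrite derivZ derivXn mnmBE mnm1E eqxx subn1 -scalerMnr.
congr (('X_[_] *: _) *+ _); apply/mnmP => j; rewrite !mnmE.
case: eqP; last by rewrite subn0.
by move=> /(congr1 val) /= /eqP; rewrite gtn_eqF.
Qed.

End Univariate.

(** * Factoriality of polynomial rings over a field *)

Section MpolyFactorial.
Variable F : fieldType.

Lemma msize_nonunit n (a : {mpoly F[n]}) :
  a != 0 -> a \isn't a GRing.unit -> (1 < msize a)%N.
Proof.
move=> a0; rewrite ltnNge; apply: contraNN => /msize1_polyC aE.
rewrite aE rmorph_unit // unitfE; apply: contraNneq a0 => c0.
by rewrite aE c0 mpolyC0.
Qed.

(** Induction on the number of variables. Irreducible elements are prime by Gauss's lemma read
    through [muni]; any other non-unit splits into two non-units, which have smaller [msize] because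
    both have positive degree. *)
Lemma mpoly_factorial n : factorial_domain {mpoly F[n]}.
Proof.
elim: n => [|n IHn] a.
  move=> a0; apply: PrimeProductUnit; apply: contraT => /(msize_nonunit a0).
  rewrite ltnNge msizeE => /negP[]; apply/bigmax_leqP_seq => m _ _.
  by rewrite mdegE big_ord0.
have [N] := ubnP (msize a); elim: N a => // N IH a szN a0.
have [Ua|nUa] := boolP (a \is a GRing.unit); first exact: PrimeProductUnit.
have [ia|nia] := pselect (irreducible_elt a).
  rewrite -[a]mulr1; apply: PrimeProductCons; last exact/PrimeProductUnit/unitr1.
  apply: (prime_elt_iso (@muniK F n) (@unmuniK F n)).
  by apply/(irreducible_prime IHn)/(irreducible_elt_iso (@muniK F n) (@unmuniK F n)).
have [b [c [aE nUb nUc]]] : exists b c, [/\ a = b * c, b \isn't a GRing.unit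
    & c \isn't a GRing.unit].
  apply: contrapT => H; apply: nia; split=> // b c aE.
  have [|nUb] := boolP (b \is a GRing.unit); first by left.
  have [|nUc] := boolP (c \is a GRing.unit); first by right.
  by case: H; exists b, c.
have b0 : b != 0 by apply: contraNneq a0 => b0; rewrite aE b0 mul0r.
have c0 : c != 0 by apply: contraNneq a0 => c0; rewrite aE c0 mulr0.
have [szb szc] := (msize_nonunit b0 nUb, msize_nonunit c0 nUc).
rewrite aE msizeM // in szN.
have aux k l : (1 < k -> 1 < l -> (k + l).-1 < N.+1 -> k < N /\ l < N)%N by lia.
have [ltb ltc] := aux _ _ szb szc szN.
by rewrite aE; apply: prime_productM; apply: IH.
Qed.

End MpolyFactorial.

(** [c] is the right side of a Bezout relation, cleared of denominators, between [muni f] and its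
    derivative: where [f] vanishes and [c] does not, the derivative cannot vanish. *)
Lemma squarefree_smooth (F : closedFieldType) (n : nat) (f : {mpoly F[n.+1]}) :
    [pchar F] =i pred0 -> squarefree f -> f != 0 ->
  exists2 c : {mpoly F[n]}, c != 0 & forall v : 'I_n.+1 -> F,
    f.@[v] = 0 -> c.@[fun i => v (widen_ord (leqnSn n) i)] != 0 ->
    (f^`M(ord_max)).@[v] != 0.
Proof.
move=> ch0 sqf f0.
have : separable_poly (muni f).
  apply: squarefree_separable.
  - exact: mpoly_factorial.
  - apply/(GRing.pcharf0P _) => k; rewrite -mpolyC_nat mpolyC_eq0.
    exact: (GRing.pcharf0P F).1.
  - by apply: contraNneq f0 => E; rewrite -[f]muniK E rmorph0.
  move=> g h E; rewrite -[g]unmuniK rmorph_unit //; apply: (sqf _ (unmuni h)).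
  by rewrite -[f]muniK E rmorphM rmorphXn.
rewrite unlock => /Bezout_coprimepP [[u v] /= /eqp_size].
rewrite size_poly1 => /eqP/size_poly1P [c c0 Ec]; exists c => // w fw0.
set w' := w \o widen_ord (leqnSn n).
pose ev : {rmorphism {poly {mpoly F[n]}} -> F} :=
  horner_eval (w ord_max) \o map_poly (meval w').
have evE p : p.@[w] = ev (muni p) by exact: meval_muni.
have cE : c.@[w'] = ev c%:P by rewrite /ev /= /horner_eval map_polyC hornerC.
rewrite evE in fw0; rewrite evE muni_deriv.
have -> : c.@[fun i => w (widen_ord (leqnSn n) i)] = ev c%:P by [].
by rewrite -Ec rmorphD !rmorphM fw0 mulr0 add0r mulf_eq0 => /norP [].
Qed.

(** * Plane curves and substitutions *)

Section Curves.
Variable F : numClosedFieldType.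

Lemma horner_eq0 (p : {poly F}) : (forall t, p.[t] = 0) -> p = 0.
Proof.
move=> H; apply/eqP; apply: contraT => /closed_nonrootP [t /negP[]].
by rewrite rootE H.
Qed.

Lemma poly_eq0_of_roots (m : nat) (c : F) (p : {poly F}) :
    (0 < m)%N -> c != 0 -> (size p <= m)%N ->
  (forall y, y ^+ m = c -> p.[y] = 0) -> p = 0.
Proof.
move=> m0 c0 szp Hp.
have [rs Ers] := closed_field_poly_normal ('X^m - c%:P : {poly F}).
have lc : lead_coef ('X^m - c%:P : {poly F}) = 1.
  by apply/eqP; exact: monicXnsubC.
rewrite lc scale1r in Ers.
have szr : size rs = m.
  by have := congr1 (fun q : {poly F} => size q) Ers; rewrite size_XnsubC // size_prod_XsubC => -[].
have urs : uniq rs.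
  rewrite -separable_prod_XsubC -Ers unlock; apply/Bezout_coprimepP.
  (* This combination of [X^m - c] and its derivative is the constant [m * c], nonzero in
     characteristic 0; so the [m] roots are distinct. *)
  exists ((- m%:R)%:P, 'X) => /=; rewrite derivB derivXn derivC subr0.
  have -> : (- m%:R)%:P * ('X^m - c%:P) + 'X * ('X^(m.-1) *+ m) = (m%:R * c)%:P :> {poly F}.
    rewrite mulrnAr -exprS prednK // -(mulr_natl 'X^m) polyCN polyC_natr polyCM polyC_natr; ring.
  by rewrite -size_poly_eq1 size_polyC mulf_neq0 // pnatr_eq0 -lt0n.
apply/eqP; apply: contraT => p0.
suff ars : all (root p) rs by have := max_poly_roots p0 ars urs; rewrite szr ltnNge szp.
apply/allP => y yrs; rewrite rootE Hp //; apply/eqP.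
have : root ('X^m - c%:P) y by rewrite Ers root_prod_XsubC.
by rewrite rootE !hornerE subr_eq0.
Qed.

(** The outer variable is [y], the inner one [t], and [D] marks exceptional values of [t]. The
    pseudo-remainder has degree below [m] in [y], yet for each [t] with [A], [B], [D] nonzero it
    vanishes at [m] distinct [y]; hence its coefficients times [A * B * D] vanish identically. *)
Lemma curve_pseudo_div (A B D : {poly F}) (m : nat) (P : {poly {poly F}}) :
    (0 < m)%N -> A != 0 -> B != 0 -> D != 0 ->
    (forall t y, D.[t] != 0 -> y != 0 -> A.[t] * y ^+ m + B.[t] = 0 ->
       P.[y%:P].[t] = 0) ->
  exists k Q, (A ^+ k)%:P * P = Q * (A%:P * 'X^m + B%:P).
Proof.
move=> m0 A0 B0 D0 HP; set E := _ + _.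
have szAX : size (A%:P * 'X^m) = m.+1 by rewrite mul_polyC size_scale ?size_polyXn.
have ltB : (size B%:P < size (A%:P * 'X^m)%R)%N.
  by rewrite szAX ltnS (leq_trans (size_polyC_leq1 _)).
have szE : size E = m.+1 by rewrite size_polyDl.
have lcE : lead_coef E = A.
  by rewrite lead_coefDl // mul_polyC lead_coefZ lead_coefXn mulr1.
have E0 : E != 0 by rewrite -size_poly_eq0 szE.
have := Pdiv.Idomain.divp_eq P E; rewrite lcE -mul_polyC.
set k := Pdiv.Idomain.scalp _ _ => Ediv.
exists k, (P %/ E); rewrite Ediv; set r := P %% E in Ediv *.
suff -> : r = 0 by rewrite addr0.
have szr : (size r <= m)%N by rewrite -ltnS -szE ltn_modp.
apply/polyP => i; rewrite coef0.
suff : r`_i * (A * B * D) = 0.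
  by move/eqP; rewrite !mulf_eq0 (negbTE A0) (negbTE B0) (negbTE D0) !orbF => /eqP.
apply: horner_eq0 => t; rewrite !hornerM.
have [->|At] := eqVneq A.[t] 0; first by rewrite !mul0r mulr0.
have [->|Bt] := eqVneq B.[t] 0; first by rewrite mulr0 !mul0r mulr0.
have [->|Dt] := eqVneq D.[t] 0; first by rewrite !mulr0.
suff rt0 : map_poly (horner_eval t) r = 0.
  have := congr1 (fun q : {poly F} => q`_i) rt0.
  by rewrite coef_map coef0 /= /horner_eval => ->; rewrite mul0r.
have ev (q : {poly {poly F}}) y : (map_poly (horner_eval t) q).[y] = q.[y%:P].[t].
  by rewrite -[y in LHS](hornerC y t) -[_.[t] in LHS]/(horner_eval t _) horner_map.
apply: (@poly_eq0_of_roots m (- (B.[t] / A.[t]))) => //.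
- by rewrite oppr_eq0 mulf_neq0 ?invr_eq0.
- by apply: leq_trans (size_poly _ _) szr.
move=> y ym; rewrite ev.
have y0 : y != 0.
  apply: contraNneq Bt => y0; move: ym; rewrite y0 expr0n gtn_eqF // => /eqP.
  by rewrite eq_sym oppr_eq0 mulf_eq0 invr_eq0 (negbTE At) orbF.
have Ey : A.[t] * y ^+ m + B.[t] = 0 by rewrite ym mulrN mulrC divfK // addNr.
have := congr1 (fun q : {poly {poly F}} => q.[y%:P].[t]) Ediv.
rewrite hornerD !hornerM hornerD (HP _ _ Dt y0 Ey) mulr0 hornerM.
by rewrite /E hornerD hornerM !hornerC hornerXn hornerD hornerM horner_exp hornerC Ey mulr0 add0r.
Qed.

End Curves.

Section Substitution.
Variable R : comNzRingType.

Lemma deriv_mmap (n : nat) (f : {mpoly R[n]}) (x : 'I_n -> {poly R}) :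
  (mmap (@polyC R) x f)^`() =
  \sum_(i < n) mmap (@polyC R) x f^`M(i) * (x i)^`().
Proof.
elim/mpoly_closed_ind: f => [c|i|p q IHp IHq|p q IHp IHq].
- by rewrite mmapC derivC big1 // => i _; rewrite mderivC mmap0 mul0r.
- rewrite mmapX mmap1U (bigD1 i) //= big1 ?addr0 => [|j ne].
    have -> : ('X_i)^`M(i) = 1 :> {mpoly R[n]}.
      rewrite mderivX mnm1E eqxx scale1r -mpolyX0; congr 'X_[_].
      by apply/mnmP => j; rewrite mnmBE mnm0E subnn.
    by rewrite rmorph1 mul1r.
  by rewrite mderivX mnm1E eq_sym (negbTE ne) scale0r mmap0 mul0r.
- rewrite mmapD derivD IHp IHq -big_split; apply: eq_bigr => i _ /=.
  by rewrite mderivD mmapD mulrDl.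
rewrite rmorphM derivM IHp IHq mulr_suml mulr_sumr -big_split.
apply: eq_bigr => i _ /=; rewrite mderivM mmapD !rmorphM /=.
by rewrite mulrDl mulrAC mulrA.
Qed.

Lemma horner_mmap (n : nat) (f : {mpoly R[n]}) (x : 'I_n -> {poly R}) (t : R) :
  (mmap (@polyC R) x f).[t] = f.@[fun i => (x i).[t]].
Proof.
elim/mpoly_closed_ind: f => [c|i|p q IHp IHq|p q IHp IHq].
- by rewrite mmapC hornerC mevalC.
- by rewrite mmapX mmap1U mevalXU.
- by rewrite mmapD hornerD IHp IHq mevalD.
- by rewrite rmorphM hornerM IHp IHq mevalM.
Qed.

Lemma horner2_mmap (n : nat) (f : {mpoly R[n]}) (x : 'I_n -> {poly {poly R}}) (t y : R) :
  (mmap (@polyC {poly R} \o @polyC R) x f).[y%:P].[t] = f.@[fun i => (x i).[y%:P].[t]].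
Proof.
elim/mpoly_closed_ind: f => [c|i|p q IHp IHq|p q IHp IHq].
- by rewrite mmapC !hornerC mevalC.
- by rewrite mmapX mmap1U mevalXU.
- by rewrite mmapD !hornerD IHp IHq mevalD.
- by rewrite rmorphM !hornerM IHp IHq mevalM.
Qed.

Lemma comp_mmap (n : nat) (f : {mpoly R[n]}) (x : 'I_n -> {poly {poly R}}) (a b : {poly R}) :
  (map_poly (comp_poly a) (mmap (@polyC {poly R} \o @polyC R) x f)).[b] =
  mmap (@polyC R) (fun i => (map_poly (comp_poly a) (x i)).[b]) f.
Proof.
elim/mpoly_closed_ind: f => [c|i|p q IHp IHq|p q IHp IHq].
- by rewrite !mmapC /= map_polyC hornerC /= comp_polyC.
- by rewrite !mmapX !mmap1U.
- by rewrite !mmapD rmorphD hornerD IHp IHq.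
- by rewrite !rmorphM hornerM IHp IHq.
Qed.

Lemma meval_mmap (k n : nat) (h : 'I_n -> {mpoly R[k]}) (g : {mpoly R[n]}) (z : 'I_k -> R) :
  (mmap (@mpolyC k R) h g).@[z] = g.@[fun i => (h i).@[z]].
Proof.
elim/mpoly_closed_ind: g => [a|i|p q IHp IHq|p q IHp IHq].
- by rewrite mmapC !mevalC.
- by rewrite mmapX mmap1U mevalXU.
- by rewrite mmapD !mevalD IHp IHq.
- by rewrite rmorphM !mevalM IHp IHq.
Qed.

End Substitution.

(** * Power sums on the torus *)

Section Torus.
Variable F : numClosedFieldType.

Definition torus_point (N : nat) (z : 'I_N -> F) := forall i, z i != 0.

Definition torus_power_sum (N : nat) (s : int) (z : 'I_N -> F) :=
  torus_point z /\ \sum_i z i ^ s = 0.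

Lemma line_horner0 (c d : F) : (c%:P + d *: 'X).[0] = c.
Proof. by rewrite hornerD hornerC hornerZ hornerX mulr0 addr0. Qed.

Lemma line_exp_deriv0 (c d : F) (m : nat) :
  ((c%:P + d *: 'X) ^+ m)^`().[0] = m%:R * (d * c ^+ m.-1).
Proof.
rewrite deriv_exp derivD derivC derivZ derivX add0r hornerMn hornerM horner_exp.
by rewrite line_horner0 hornerZ hornerC mulr1 mulr_natl.
Qed.

(** [A * y ^ m + B] is the equation of the curve cleared of denominators, with [m] the absolute
    value of [s]. The direction of [(a, b)] is orthogonal to the gradient
    [s * (t ^ (s - 1), y ^ (s - 1))], so along this tangent line the equation [e] vanishes to second
    order. *)
Lemma plane_curve (s : int) (C : F) : s != 0 ->
  exists m A B, [/\ (0 < m)%N, A != 0, B != 0,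
    forall t y, t != 0 -> y != 0 ->
      A.[t] * y ^+ m + B.[t] = 0 -> t ^ s + y ^ s + C = 0
  & forall t y, t != 0 -> y != 0 -> t ^ s + y ^ s + C = 0 ->
      let a := t%:P + (t ^ (1 - s)) *: 'X in
      let b := y%:P + (- y ^ (1 - s)) *: 'X in
      let e := (A \Po a) * b ^+ m + (B \Po a) in
      [/\ A.[t] != 0, e.[0] = 0 & e^`().[0] = 0]].
Proof.
case: s => [[//|k]|k] _.
  set m := k.+1.
  have szB : size ('X^m + C%:P) = m.+1.
    by rewrite size_polyDl size_polyXn // ltnS (leq_trans (size_polyC_leq1 _)).
  exists m, 1, ('X^m + C%:P); split=> //; first exact: oner_neq0.
  - by rewrite -size_poly_eq0 szB.
  - move=> t y _ _; rewrite hornerC mul1r hornerD hornerXn hornerC -!exprnP => <-.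
    by rewrite addrA (addrC (y ^+ _)).
  move=> t y t0 y0; rewrite -!exprnP => E a b e.
  have h (x : F) : x != 0 -> x ^ (1 - m%:Z) * x ^+ m.-1 = 1.
    move=> x0; have -> : 1 - m%:Z = - k%:Z by lia.
    by rewrite -exprnN mulVf ?expf_neq0.
  have -> : e = b ^+ m + (a ^+ m + C%:P).
    by rewrite /e comp_polyC mul1r comp_polyD comp_polyC comp_Xn_poly.
  split; first by rewrite hornerC oner_neq0.
    rewrite !hornerD !horner_exp hornerC /a /b !line_horner0 -E.
    by rewrite addrA (addrC (y ^+ _)).
  rewrite !derivD derivC addr0 hornerD !line_exp_deriv0.
  by rewrite mulNr !h // mulrN addNr.
(* For negative exponents the equation is multiplied by [t ^ m * y ^ m]. *)
set m := k.+1; exists m, (1 + C *: 'X^m), ('X^m).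
have hA t : (1 + C *: 'X^m).[t] = 1 + C * t ^+ m.
  by rewrite hornerD hornerC hornerZ hornerXn.
split=> //.
- apply/eqP => /(congr1 (fun p => p.[0])) /eqP.
  by rewrite hA horner0 expr0n mulr0 addr0 oner_eq0.
- by rewrite -size_poly_eq0 size_polyXn.
- move=> t y t0 y0; rewrite hA hornerXn NegzE -!exprnN => E.
  have [T0 Y0] : t ^+ m != 0 /\ y ^+ m != 0 by rewrite !expf_neq0.
  apply: (mulfI (mulf_neq0 T0 Y0)); rewrite mulr0 -E; field.
  by rewrite ?t0 ?y0 ?T0 ?Y0.
move=> t y t0 y0; rewrite NegzE opprK -!exprnN => E a b e.
have [T0 Y0] : t ^+ m != 0 /\ y ^+ m != 0 by rewrite !expf_neq0.
have CE : C = - (t ^- m + y ^- m) by apply/eqP; rewrite -addr_eq0 addrC E.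
have eE : e = (1 + C *: a ^+ m) * b ^+ m + a ^+ m.
  by rewrite /e comp_polyD comp_polyZ comp_Xn_poly comp_polyC.
have h (x : F) : x ^ (1 + m%:Z) * x ^+ m.-1 = x ^+ m * x ^+ m.
  by rewrite -!exprD; congr (_ ^+ _); rewrite /m; lia.
split.
- rewrite hA CE; have -> : 1 + - (t ^- m + y ^- m) * t ^+ m = - (t ^+ m / y ^+ m).
    by field; rewrite ?t0 ?y0 ?T0 ?Y0.
  by rewrite oppr_eq0 mulf_neq0 ?invr_eq0.
- rewrite eE hornerD hornerM hornerD hornerC hornerZ !horner_exp !line_horner0 CE.
  by field; rewrite ?t0 ?y0 ?T0 ?Y0.
rewrite eE derivD derivM derivD derivC derivZ add0r !(hornerD, hornerM, hornerZ, hornerC).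
rewrite !horner_exp !line_exp_deriv0 !line_horner0 mulNr !h CE.
by field; rewrite ?t0 ?y0 ?T0 ?Y0.
Qed.

(* Both coordinates [z i] and [z j] move along the tangent line of the plane curve
   [t ^ s + y ^ s + C = 0], on which [f] restricted to the other coordinates is
   divisible by the equation of the curve. *)
Lemma power_sum_tangent2 (n : nat) (f : {mpoly F[n]}) (s : int) (r : nat) :
    s != 0 -> (0 < r)%N ->
    (forall z, torus_power_sum s z -> f.@[fun i => z i ^+ r] = 0) ->
  forall z, torus_power_sum s z -> forall i j,
    (f^`M(i)).@[fun i => z i ^+ r] * z i ^ (r%:Z - s)
    = (f^`M(j)).@[fun i => z i ^+ r] * z j ^ (r%:Z - s).
Proof.
move=> s0 r0 fW z [z0 zs] i j; have [->//|ne_ij] := eqVneq i j.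
have sum_split (w : 'I_n -> F) (t y : F) : w i = t -> w j = y ->
    (forall l, l != i -> l != j -> w l = z l) ->
    \sum_l w l ^ s = t ^ s + y ^ s + \sum_(l | (l != i) && (l != j)) z l ^ s.
  move=> wi wj wl; rewrite (bigD1 i) //= (bigD1 j) 1?eq_sym //= wi wj addrA.
  by congr (_ + _); apply: eq_bigr => l /andP[li lj]; rewrite wl.
set C := \sum_(l | _) _ in sum_split.
have [m [A [B [m0 A0 B0 curveP tangentP]]]] := plane_curve C s0.
pose x l : {poly {poly F}} :=
  if l == i then ('X^r)%:P else if l == j then 'X^r else (z l ^+ r)%:P%:P.
pose P := mmap (@polyC {poly F} \o @polyC F) x f.
have [k [Q EQ]] : exists k Q, (A ^+ k)%:P * P = Q * (A%:P * 'X^m + B%:P).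
  apply: (@curve_pseudo_div _ A B 'X) => // [|t y].
    by rewrite polyX_eq0.
  rewrite hornerX => t0 y0 E; rewrite horner2_mmap.
  pose w l := if l == i then t else if l == j then y else z l.
  have wW : torus_power_sum s w.
    split=> [l|]; first by rewrite /w; do 2!case: ifP => _ //.
    rewrite (sum_split w t y) ?(curveP t y) ///w ?eqxx // => [|l /negbTE-> /negbTE->] //.
    by rewrite eq_sym (negbTE ne_ij).
  rewrite -[RHS](fW _ wW); apply: meval_eq => l; rewrite /x /w.
  case: ifP => _; first by rewrite hornerC hornerXn.
  by case: ifP => _; rewrite ?hornerXn ?hornerC // -rmorphXn hornerC.
have Ez : z i ^ s + z j ^ s + C = 0 by rewrite -(sum_split z).
pose a := (z i)%:P + (z i ^ (1 - s)) *: 'X.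
pose b := (z j)%:P + (- z j ^ (1 - s)) *: 'X.
pose e := (A \Po a) * b ^+ m + (B \Po a).
have [Ai e0 e'0] : [/\ A.[z i] != 0, e.[0] = 0 & e^`().[0] = 0] := tangentP _ _ (z0 i) (z0 j) Ez.
pose ev : {rmorphism {poly {poly F}} -> {poly F}} :=
  horner_eval b \o map_poly (comp_poly a).
have evC c : ev c%:P = c \Po a by rewrite /ev /= /horner_eval map_polyC hornerC.
have evX : ev 'X = b by rewrite /ev /= /horner_eval map_polyX hornerX.
(* Restriction to the tangent line: [e] has a double zero at 0 and [A] is nonzero at [z i], so the
   restriction of [P] also vanishes there with its derivative. The chain rule then leaves only the
   contributions of [i] and [j]. *)
have {}EQ : (A \Po a) ^+ k * ev P = ev Q * e.
  by rewrite /e -!evC -evX -!rmorphXn -!rmorphM -rmorphD -rmorphM /= EQ.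
have Ak0 : ((A \Po a) ^+ k).[0] == 0 = false.
  by rewrite horner_exp expf_eq0 horner_comp line_horner0 (negbTE Ai) andbF.
have p0 : (ev P).[0] = 0.
  have := congr1 (fun h => h.[0]) EQ; rewrite !hornerM e0 mulr0 => /eqP.
  by rewrite mulf_eq0 Ak0 => /eqP.
have {p0 EQ} : (ev P)^`().[0] = 0.
  have := congr1 (fun h => h^`().[0]) EQ; rewrite !derivM !hornerD !hornerM e0 e'0 p0.
  by rewrite !mulr0 !add0r => /eqP; rewrite mulf_eq0 Ak0 => /eqP.
rewrite /ev /= /horner_eval comp_mmap deriv_mmap horner_sum.
pose g l := (f^`M(l)).@[fun i => z i ^+ r].
pose d l := if l == i then r%:R * (z i ^ (1 - s) * z i ^+ r.-1) else
            if l == j then r%:R * (- z j ^ (1 - s) * z j ^+ r.-1) else 0.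
rewrite (eq_bigr (fun l => g l * d l)) => [|l _]; last first.
  have vx l' : (map_poly (comp_poly a) (x l')).[b].[0] = z l' ^+ r.
    rewrite /x; case: eqP => [->|_].
      by rewrite map_polyC hornerC /= comp_Xn_poly horner_exp line_horner0.
    case: eqP => [->|_]; first by rewrite map_polyXn hornerXn horner_exp line_horner0.
    by rewrite map_polyC hornerC /= comp_polyC hornerC.
  rewrite hornerM horner_mmap (meval_eq _ vx); congr (_ * _).
  rewrite /x /d; case: eqP => [_|_].
    by rewrite map_polyC hornerC /= comp_Xn_poly line_exp_deriv0.
  case: eqP => [_|_]; first by rewrite map_polyXn hornerXn line_exp_deriv0.
  by rewrite map_polyC hornerC /= comp_polyC derivC horner0.
rewrite (bigD1 i) //= (bigD1 j) 1?eq_sym //= big1 ?addr0 => [|l /andP[li lj]]; last first.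
  by rewrite /d (negbTE li) (negbTE lj) mulr0.
rewrite /d !eqxx (eq_sym j) (negbTE ne_ij).
have shift l : z l ^ (1 - s) * z l ^+ r.-1 = z l ^ (r%:Z - s).
  rewrite exprnP -expfzDr //; congr (_ ^ _); lia.
rewrite mulNr !shift -/(g i) -/(g j).
move: (z i ^ _) (z j ^ _) (g i) (g j) => ti tj gi gj.
have -> : gi * (r%:R * ti) + gj * (r%:R * - tj) = r%:R * (gi * ti - gj * tj) by ring.
move=> /eqP; rewrite mulf_eq0 pnatr_eq0 eqn0Ngt r0 /= subr_eq0.
by move=> /eqP.
Qed.
End Torus.

(** * Gradients at powers of torus points, and density of generic points *)

Section Density.
Variable F : numClosedFieldType.

(** [h] is the common value of the products compared in [power_sum_tangent2]. It may be zero, so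
    smoothness has to be secured separately. *)
Lemma power_sum_tangent (n : nat) (f : {mpoly F[n.+1]}) (s : int) (r : nat) :
    s != 0 -> (0 < r)%N ->
    (forall z, torus_power_sum s z -> f.@[fun i => z i ^+ r] = 0) ->
  forall z, torus_power_sum s z ->
    exists h, forall i, (f^`M(i)).@[fun i => z i ^+ r] = h * z i ^ (s - r%:Z).
Proof.
move=> s0 r0 fW z Wz; have [z0 _] := Wz.
exists ((f^`M(ord0)).@[fun i => z i ^+ r] * z ord0 ^ (r%:Z - s)) => i.
rewrite (power_sum_tangent2 s0 r0 fW Wz ord0 i) -mulrA -expfzDr //.
by rewrite addrA subrK subrr mulr1.
Qed.

Lemma mpoly_neq0_point (n : nat) (p : {mpoly F[n]}) :
  p != 0 -> exists v, p.@[v] != 0.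
Proof.
elim: n p => [|n IH] p p0.
  have /msize_poly1P [c c0 ->] : msize p == 1%N.
    rewrite eqn_leq lt0n msize_poly_eq0 p0 andbT msizeE.
    by apply/bigmax_leqP_seq => m _ _; rewrite mdegE big_ord0.
  by exists (fun=> 0); rewrite mevalC.
have mp0 : muni p != 0 by apply: contraNneq p0 => E; rewrite -[p]muniK E rmorph0.
have [v Hv] : exists v, (lead_coef (muni p)).@[v] != 0.
  by apply: IH; rewrite lead_coef_eq0.
have /closed_nonrootP [y Hy] : map_poly (meval v) (muni p) != 0.
  apply: contraNneq Hv => E; have := congr1 (fun q : {poly F} => q`_(size (muni p)).-1) E.
  by rewrite coef_map coef0 => ->.
exists (fun i => if unlift ord_max i is Some j then v j else y).
rewrite meval_muni unlift_none -rootE.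
congr (~~ root _ y): Hy; apply: eq_map_poly => c; apply: meval_eq => j /=.
have -> : widen_ord (leqnSn n) j = lift ord_max j.
  by apply: val_inj; rewrite /= /bump leqNgt ltn_ord.
by rewrite liftK.
Qed.

(* Coefficients of the equation [A * y ^ `|s| + B = 0] of the power sum of exponent
   [s] as an equation for the last coordinate [y]. *)
Definition psum_lead (R : comNzRingType) (N : nat) (s : int) (u : 'I_N -> R) : R :=
  if s is Negz m then \sum_i \prod_(l | l != i) u l ^+ m.+1 else 1.

Definition psum_const (R : comNzRingType) (N : nat) (s : int) (u : 'I_N -> R) : R :=
  if s is Posz m then \sum_i u i ^+ m else \prod_l u l ^+ `|s|.

Lemma rmorph_psum_lead (R S : comNzRingType) (phi : {rmorphism R -> S}) N s (u : 'I_N -> R) :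
  phi (psum_lead s u) = psum_lead s (phi \o u).
Proof.
case: s => m /=; first by rewrite rmorph1.
rewrite rmorph_sum; apply: eq_bigr => i _; rewrite rmorph_prod.
by apply: eq_bigr => l _; rewrite rmorphXn.
Qed.

Lemma rmorph_psum_const (R S : comNzRingType) (phi : {rmorphism R -> S}) N s (u : 'I_N -> R) :
  phi (psum_const s u) = psum_const s (phi \o u).
Proof.
case: s => m /=; [rewrite rmorph_sum | rewrite rmorph_prod];
  by apply: eq_bigr => i _; rewrite rmorphXn.
Qed.

Lemma sum_prod_neq N m (u : 'I_N -> F) : torus_point u ->
  \sum_i \prod_(l | l != i) u l ^+ m = (\prod_l u l ^+ m) * \sum_i u i ^- m.
Proof.
move=> u0; rewrite mulr_sumr; apply: eq_bigr => i _.
by rewrite [in RHS](bigD1 i) //= mulrAC mulfV ?mul1r // expf_neq0.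
Qed.

Lemma psum_eqP N (s : int) (u : 'I_N -> F) (y : F) :
    torus_point u -> y != 0 ->
  (psum_lead s u * y ^+ `|s| + psum_const s u == 0) = (\sum_i u i ^ s + y ^ s == 0).
Proof.
move=> u0 y0; case: s => m /=; first by rewrite mul1r addrC.
rewrite sum_prod_neq // NegzE -exprnN.
have -> : (\sum_i u i ^ (- m.+1%:Z)) = \sum_i u i ^- m.+1.
  by apply: eq_bigr => i _; rewrite exprnN.
set U := \prod_l _; set S := \sum_i _.
have U0 : U != 0 by apply/prodf_neq0 => i _; apply: expf_neq0.
have Y0 : y ^+ m.+1 != 0 by rewrite expf_neq0.
have -> : U * S * y ^+ m.+1 + U = U * y ^+ m.+1 * (S + y ^- m.+1).
  by field; rewrite ?y0 ?Y0.
by rewrite !mulf_eq0 (negbTE U0) (negbTE Y0).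
Qed.

Lemma torus_power_sum_split n s (z : 'I_n.+1 -> F) :
  torus_power_sum s z <->
  [/\ torus_point (fun i : 'I_n => z (widen_ord (leqnSn n) i)), z ord_max != 0
    & psum_lead s (fun i : 'I_n => z (widen_ord (leqnSn n) i)) * z ord_max ^+ `|s|
      + psum_const s (fun i : 'I_n => z (widen_ord (leqnSn n) i)) = 0].
Proof.
rewrite /torus_power_sum big_ord_recr /=; split=> [[z0 E]|[u0 y0 /eqP]].
  by split=> [i||]; rewrite ?z0 //; apply/eqP; rewrite psum_eqP // ?E // => i.
rewrite psum_eqP // => /eqP; split=> // i.
by have [->|[j ->]] := ord_widenP i.
Qed.

(* The point [z] is joined by a line, in the coordinates other than the last, to a
   point where [c] does not vanish; over this line the power sum hypersurface is a
   plane curve. *)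
Lemma power_sum_dense (n : nat) (c : {mpoly F[n]}) (s : int) (r : nat) (G : {mpoly F[n.+1]}) :
    (0 < n)%N -> s != 0 -> (0 < r)%N -> c != 0 ->
    (forall z, torus_power_sum s z ->
       c.@[fun i => z (widen_ord (leqnSn n) i) ^+ r] != 0 -> G.@[z] = 0) ->
  forall z : 'I_n.+1 -> F,
    psum_lead s (fun i : 'I_n => z (widen_ord (leqnSn n) i)) != 0 ->
    psum_lead s (fun i : 'I_n => z (widen_ord (leqnSn n) i)) * z ord_max ^+ `|s|
      + psum_const s (fun i : 'I_n => z (widen_ord (leqnSn n) i)) = 0 ->
  G.@[z] = 0.
Proof.
move=> n0 s0 r0 c0 HG z; set z' := fun i => _ => Az Ez.
have rootr (v : 'I_n -> F) : exists w : 'I_n -> F, forall i, w i ^+ r = v i.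
  by exists (fun i => r.-root (v i)) => i; rewrite rootCK.
pose Ec : {mpoly F[n]} := mmap (@mpolyC n F) (fun i => 'X_i ^+ r) c.
have EcE w : Ec.@[w] = c.@[fun i => w i ^+ r].
  by rewrite meval_mmap; apply: meval_eq => i; rewrite rmorphXn /= mevalXU.
have Ec0 : Ec != 0.
  have [v Hv] := mpoly_neq0_point c0; have [w Hw] := rootr v.
  by apply: contraNneq Hv => E; rewrite -(meval_eq _ Hw) -EcE E meval0.
have evX w : meval w \o (fun i => 'X_i) = w :> ('I_n -> F).
  by apply/funext => i /=; rewrite mevalXU.
have n1 : n%:R != 0 :> F by rewrite pnatr_eq0 -lt0n.
(* At the point with all coordinates 1, each coefficient is 1 or [n], nonzero because [0 < n]. *)
have A0 : psum_lead s (fun i => 'X_i : {mpoly F[n]}) != 0.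
  suff : (psum_lead s (fun i => 'X_i : {mpoly F[n]})).@[fun=> 1] != 0.
    by apply: contraNneq => ->; rewrite meval0.
  rewrite rmorph_psum_lead evX; case: (s) => m /=; first exact: oner_neq0.
  rewrite (eq_bigr (fun=> 1)) ?sumr_const ?card_ord // => i _.
  by rewrite big1 // => l _; rewrite expr1n.
have B0 : psum_const s (fun i => 'X_i : {mpoly F[n]}) != 0.
  suff : (psum_const s (fun i => 'X_i : {mpoly F[n]})).@[fun=> 1] != 0.
    by apply: contraNneq => ->; rewrite meval0.
  rewrite rmorph_psum_const evX; case: (s) => m /=; last first.
    by rewrite big1 ?oner_neq0 // => l _; rewrite expr1n.
  by rewrite (eq_bigr (fun=> 1)) ?sumr_const ?card_ord // => i _; rewrite expr1n.
have X0 : \prod_(i < n) 'X_i != 0 :> {mpoly F[n]}.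
  by apply/prodf_neq0 => i _; rewrite -msize_poly_eq0 msizeX.
(* [w] is a generic end point: as [L] reaches it at parameter 1, the coefficients of the curve and
   [D], which marks the parameters leaving the torus or killing [c], are nonzero polynomials. *)
have [w] := mpoly_neq0_point (mulf_neq0 (mulf_neq0 Ec0 X0) (mulf_neq0 A0 B0)).
rewrite !mevalM !mulf_eq0 !negb_or EcE rmorph_psum_lead rmorph_psum_const !evX.
move=> /andP[/andP[cw Xw] /andP[Aw Bw]].
pose L i : {poly F} := (z' i)%:P + (w i - z' i) *: 'X.
have L0 i : (L i).[0] = z' i by rewrite line_horner0.
have L1 i : (L i).[1] = w i by rewrite hornerD hornerC hornerZ hornerX mulr1 addrC subrK.
have AL t : (psum_lead s L).[t] = psum_lead s (fun i => (L i).[t]).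
  exact: (rmorph_psum_lead (horner_eval t)).
have BL t : (psum_const s L).[t] = psum_const s (fun i => (L i).[t]).
  exact: (rmorph_psum_const (horner_eval t)).
pose D := (\prod_i L i) * mmap (@polyC F) (fun i => L i ^+ r) c.
have DE t : D.[t] = (\prod_i (L i).[t]) * c.@[fun i => (L i).[t] ^+ r].
  rewrite hornerM horner_prod horner_mmap; congr (_ * _).
  by apply: meval_eq => i; rewrite horner_exp.
have eL1 : (fun i => (L i).[1]) = w by apply/funext.
have eL0 : (fun i => (L i).[0]) = z' by apply/funext.
have nz1 (p : {poly F}) : p.[1] != 0 -> p != 0.
  by apply: contraNneq => ->; rewrite horner0.
pose x i : {poly {poly F}} := if unlift ord_max i is Some j then (L j)%:P else 'X.
have liftE (j : 'I_n) : widen_ord (leqnSn n) j = lift ord_max j.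
  by apply: val_inj; rewrite /= /bump leqNgt ltn_ord.
have xw j : x (widen_ord (leqnSn n) j) = (L j)%:P by rewrite /x liftE liftK.
have xm : x ord_max = 'X by rewrite /x unlift_none.
pose P := mmap (@polyC {poly F} \o @polyC F) x G.
have [k [Q EQ]] : exists k Q, (psum_lead s L ^+ k)%:P * P
    = Q * ((psum_lead s L)%:P * 'X^`|s|%N + (psum_const s L)%:P).
  apply: (@curve_pseudo_div _ _ _ D).
  - by rewrite absz_gt0.
  - by apply: nz1; rewrite AL eL1.
  - by apply: nz1; rewrite BL eL1.
  - apply: nz1; rewrite DE mulf_neq0 //.
      move: Xw; rewrite rmorph_prod => /prodf_neq0 Xw; apply/prodf_neq0 => i _.
      by rewrite L1; have := Xw i isT; rewrite /= mevalXU.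
    by congr (meval _ _ != 0): cw; apply/funext => i; rewrite L1.
  move=> t y; rewrite DE AL BL mulf_eq0 negb_or => /andP[/prodf_neq0 Lt ct] y0 E.
  rewrite horner2_mmap; apply: HG.
    apply/torus_power_sum_split; rewrite xm hornerX hornerC; split=> //.
      by move=> i; rewrite xw hornerC; apply: Lt.
    by have -> : (fun i => (x (widen_ord (leqnSn n) i)).[y%:P].[t]) = (fun i => (L i).[t])
      by apply/funext => i; rewrite xw hornerC.
  by congr (meval _ _ != 0): ct; apply/funext => i; rewrite xw hornerC.
(* Parameter 0 with last coordinate [z ord_max] is the point [z]: the curve equation vanishes there
   and its leading coefficient does not, by [Az]. *)
have := congr1 (fun q => q.[(z ord_max)%:P].[0]) EQ.
rewrite !hornerM !hornerD !hornerM !hornerC hornerXn horner2_mmap.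
rewrite !horner_exp hornerC AL BL eL0 Ez mulr0 => /eqP.
rewrite mulf_eq0 expf_eq0 (negbTE Az) andbF /= => /eqP; rewrite -[RHS]/0 => <-.
apply: meval_eq => i; have [->|[j ->]] := ord_widenP i.
  by rewrite xm hornerX hornerC.
by rewrite xw hornerC L0.
Qed.

End Density.

(** * Generalised power sum hypersurfaces *)

Section PowerSumHypersurfaces.
Local Open Scope classical_set_scope.
Variable F : numClosedFieldType.

(* At a point with several zero coordinates, let one of them be [y] and the others
   be [t]: the power sum hypersurface then contains the plane curve
   [(k + C * t ^ m) * y ^ m + t ^ m = 0] through the origin, with [k > 0]. *)
Lemma neg_power_sum_closure (n m : nat) (G : {mpoly F[n]}) (x : 'I_n -> F) :
    (0 < m)%N ->
    (forall z : 'I_n -> F, torus_power_sum (- m%:Z) z -> G.@[z] = 0) ->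
  \sum_i \prod_(l | l != i) x l ^+ m = 0 -> G.@[x] = 0.
Proof.
move=> m0 HG xs; have [tx|ntx] := pselect (torus_point x).
  apply: HG; split=> //; apply/eqP; move/eqP: xs; rewrite sum_prod_neq // mulf_eq0.
  have -> /= : (\prod_l x l ^+ m == 0) = false.
    by apply/negbTE/prodf_neq0 => l _; rewrite expf_neq0.
  by under [X in _ -> X == 0]eq_bigr do rewrite -exprnN.
have [i xi] : exists i, x i = 0.
  by apply: contrapT => H; apply: ntx => i; apply/eqP => xi; apply: H; exists i.
(* Every term except the one of index [i] contains [x i = 0], so that term vanishes too and yields a
   second zero coordinate. *)
have [j ne_ji xj] : exists2 j, j != i & x j = 0.
  move/eqP: xs; rewrite (bigD1 i) //= [X in _ + X]big1 ?addr0 => [/prodf_eq0 [j ne_ji]|l ne_li].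
    by rewrite expf_eq0 => /andP[_ /eqP]; exists j.
  by rewrite (bigD1 i) 1?eq_sym //= xi expr0n gtn_eqF // mul0r.
pose k := #|[pred l | (l != i) && (x l == 0)]|.
have k0 : k%:R != 0 :> F.
  by rewrite pnatr_eq0 -lt0n; apply/card_gt0P; exists j; rewrite inE ne_ji xj eqxx.
pose C := \sum_(l | (l != i) && (x l != 0)) x l ^ (- m%:Z).
pose A : {poly F} := k%:R%:P + C *: 'X^m.
have AE t : A.[t] = k%:R + C * t ^+ m by rewrite hornerD hornerC hornerZ hornerXn.
pose w (t y : F) l := if l == i then y else if x l == 0 then t else x l.
pose X l : {poly {poly F}} :=
  if l == i then 'X else if x l == 0 then 'X%:P else (x l)%:P%:P.
have XE t y l : (X l).[y%:P].[t] = w t y l.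
  rewrite /X /w; case: ifP => _; first by rewrite hornerX hornerC.
  by case: ifP => _; rewrite ?hornerC ?hornerX.
pose P := mmap (@polyC {poly F} \o @polyC F) X G.
have PE t y : P.[y%:P].[t] = G.@[w t y].
  by rewrite horner2_mmap; apply: meval_eq => l; rewrite XE.
have [|||||k' [Q EQ]] := @curve_pseudo_div F A 'X^m 'X m P.
- by [].
- apply/eqP => /(congr1 (fun p => p.[0])) /eqP.
  by rewrite AE horner0 expr0n gtn_eqF // mulr0 addr0 (negbTE k0).
- by rewrite -size_poly_eq0 size_polyXn.
- by rewrite polyX_eq0.
- move=> t y; rewrite hornerX AE hornerXn PE => t0 y0 E; apply: HG.
  split=> [l|]; first by rewrite /w; case: ifP => // _; case: ifPn.
  rewrite (bigD1 i) //= (bigID (fun l => x l == 0)) /=.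
  rewrite [w _ _ i]/w eqxx (eq_bigr (fun=> t ^ (- m%:Z))); last first.
    by move=> l /andP[/negbTE li /eqP xl]; rewrite /w li xl eqxx.
  rewrite sumr_const -/k [X in _ + (_ + X)](_ : _ = C); last first.
    by apply: eq_bigr => l /andP[/negbTE li /negbTE xl]; rewrite /w li xl.
  rewrite -!exprnN.
  have [T0 Y0] : t ^+ m != 0 /\ y ^+ m != 0 by rewrite !expf_neq0.
  apply: (mulfI (mulf_neq0 T0 Y0)); rewrite mulr0 -E -mulr_natl; field.
  by rewrite ?t0 ?y0 ?T0 ?Y0.
(* At the origin the curve equation vanishes while [A] takes the nonzero value [k]; the point
   [w 0 0] is [x]. *)
have := congr1 (fun q => q.[0%:P].[0]) EQ.
rewrite !hornerM !hornerD !hornerM !hornerC hornerXn PE.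
rewrite !horner_exp hornerC AE hornerX expr0n gtn_eqF // !mulr0 !addr0 mulr0 => /eqP.
rewrite mulf_eq0 expf_eq0 (negbTE k0) andbF /= => /eqP <-.
apply: meval_eq => l; rewrite /w; case: eqP => [->|_]; first by rewrite xi.
by case: eqP.
Qed.

Lemma dhomog_scale (n d : nat) (g : {mpoly F[n]}) (c : F) (v : 'I_n -> F) :
  g \is d.-homog -> g.@[fun i => c * v i] = c ^+ d * g.@[v].
Proof.
move=> /dhomogP hg; rewrite !mevalE mulr_sumr [LHS]big_seq [RHS]big_seq.
apply: eq_bigr => m /hg <-; rewrite mulrCA; congr (_ * _).
by rewrite /= mdegE -prodrXr -big_split; apply: eq_bigr => i _; rewrite exprMn.
Qed.

Section ProjectiveSpace.
Variable n : nat.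
Implicit Types (s r : int) (f : {mpoly F[n.+1]}).

(** For nonzero [s] it depends only on [s / r], and its closure describes the hypersurface uniformly
    for both signs of [r]. *)
Definition power_sum_torus_image s r : set 'rV[F]_n.+1 :=
  [set y : 'rV[F]_n.+1 | exists (z : 'I_n.+1 -> F) (c : F),
    [/\ torus_power_sum s z, c != 0 & y = c *: \row_i (z i ^ r)]].

Lemma power_sum_torus_image_neq0 s r y : power_sum_torus_image s r y -> y != 0.
Proof.
case=> z [c [[z0 _] c0 ->]]; rewrite scaler_eq0 negb_or c0.
by apply/eqP => /rowP /(_ ord0) /eqP; rewrite !mxE expfz_eq0 (negbTE (z0 _)) andbF.
Qed.

Lemma exprz_root (k : int) (x : F) : k != 0 -> x != 0 -> exists2 y, y != 0 & y ^ k = x.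
Proof.
case: k => m k0 x0; [pose u := x | pose u := x^-1].
  exists (m.-root x); last by rewrite -exprnP rootCK // lt0n.
  by rewrite rootC_eq0 // lt0n.
exists (m.+1.-root x^-1); first by rewrite rootC_eq0 // invr_eq0.
by rewrite NegzE -exprnN rootCK // invrK.
Qed.

(** The coordinate-wise [k]-th power maps the torus onto itself, roots being available in [F]. *)
Lemma power_sum_torus_image_scale k s r : k != 0 ->
  power_sum_torus_image (k * s) (k * r) = power_sum_torus_image s r.
Proof.
move=> k0; apply/seteqP; split=> y [z [c [[z0 zs] c0 ->]]].
  exists (fun i => z i ^ k), c; split=> //; last first.
    by congr (_ *: _); apply/rowP => i; rewrite !mxE exprz_exp.
  split=> [i|]; first by rewrite expfz_neq0.
  by rewrite -[RHS]zs; apply: eq_bigr => i _; rewrite exprz_exp.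
have /boolp.choice [w Hw] : forall i, exists w, w != 0 /\ w ^ k = z i.
  by move=> i; have [w] := exprz_root k0 (z0 i); exists w.
exists w, c; split=> //; last first.
  by congr (_ *: _); apply/rowP => i; rewrite !mxE -exprz_exp (Hw i).2.
split=> [i|]; first exact: (Hw i).1.
by rewrite -[RHS]zs; apply: eq_bigr => i _; rewrite -exprz_exp (Hw i).2.
Qed.

Lemma power_sum_torus_image_eq s r s' r' : s != 0 -> s' != 0 -> s * r' = s' * r ->
  power_sum_torus_image s r = power_sum_torus_image s' r'.
Proof.
move=> s0 s'0 E; rewrite -(power_sum_torus_image_scale s r s'0).
by rewrite -(power_sum_torus_image_scale s' r' s0) E mulrC.
Qed.

Lemma meval_power_sum s (z : 'I_n.+1 -> F) : s != 0 ->
  (power_sum F n s).@[z] = if s is Negz m then \sum_i \prod_(l | l != i) z l ^+ m.+1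
                           else \sum_i z i ^ s.
Proof.
case: s => [[|m]|m] //= _; rewrite rmorph_sum; apply: eq_bigr => i _.
  by rewrite rmorphXn /= mevalXU.
by rewrite rmorph_prod; apply: eq_bigr => l _; rewrite rmorphXn /= mevalXU.
Qed.

Lemma power_sum_torus s (z : 'I_n.+1 -> F) : s != 0 -> torus_point z ->
  (power_sum F n s).@[z] = 0 <-> \sum_i z i ^ s = 0.
Proof.
move=> s0 z0; rewrite meval_power_sum //; case: s s0 => // m _.
rewrite sum_prod_neq //.
have U0 : \prod_l z l ^+ m.+1 != 0 by apply/prodf_neq0 => l _; rewrite expf_neq0.
have -> : \sum_i z i ^ Negz m = \sum_i z i ^- m.+1.
  by apply: eq_bigr => i _; rewrite NegzE exprnN.
split=> [/eqP|->]; last by rewrite mulr0.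
by rewrite mulf_eq0 (negbTE U0) => /eqP.
Qed.

(** For [s > 0] the leading coefficient is 1, so [power_sum_dense] with [c = 1] reaches every point,
    zero coordinates included; for [s < 0] this is [neg_power_sum_closure]. *)
Lemma power_sum_vanish s (G : {mpoly F[n.+1]}) : (0 < n)%N -> s != 0 ->
    (forall z : 'I_n.+1 -> F, torus_power_sum s z -> G.@[z] = 0) ->
  forall x : 'I_n.+1 -> F, (power_sum F n s).@[x] = 0 -> G.@[x] = 0.
Proof.
move=> n0 s0 HG x; rewrite meval_power_sum //; case: s s0 HG => m s0 HG.
  move=> xs; apply: (@power_sum_dense F n 1 m 1 G) => //.
  - by rewrite oner_neq0.
  - by move=> z /HG.
  - exact: oner_neq0.
  by rewrite /= mul1r addrC -[RHS]xs big_ord_recr.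
by apply: neg_power_sum_closure => // z; rewrite -NegzE; apply: HG.
Qed.

Lemma torus_coord_image s r : s != 0 ->
  coord_power_image r (proj_zeros (power_sum F n s) `\` @coord_hyperplanes F n)
  = power_sum_torus_image s r.
Proof.
move=> s0; apply/seteqP; split=> y.
  case=> x [c [[[x0 xs] nx] c0 ->]]; exists (x 0), c; split=> //.
  have tx : torus_point (x 0).
    move=> i; apply/eqP => xi; apply: nx; split=> //.
    by rewrite rmorph_prod (bigD1 i) //= mevalXU xi mul0r.
  by split=> //; apply/power_sum_torus.
case=> z [c [[z0 zs] c0 ->]]; exists (\row_i z i), c; split=> //; last first.
  by congr (_ *: _); apply/rowP => i; rewrite !mxE.
have rz : (\row_i z i) 0 =1 z by move=> i; rewrite mxE.
split; first split.
- by apply/eqP => /rowP /(_ ord0) /eqP; rewrite !mxE (negbTE (z0 _)).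
- by rewrite (meval_eq _ rz); apply/power_sum_torus.
move=> [_]; rewrite (meval_eq _ rz) rmorph_prod /= => /eqP/prodf_eq0 [i _].
by rewrite mevalXU (negbTE (z0 i)).
Qed.

Lemma sub_zariski_closure (X : set 'rV[F]_n.+1) f d :
  f \is d.-homog -> (forall y, X y -> f.@[y 0] = 0) ->
  zariski_closure X `<=` proj_zeros f.
Proof. by move=> hf Xf x [x0 Hx]; split=> //; apply: Hx hf Xf. Qed.

Lemma gen_power_sumP (p : rat) f s r : (0 < n)%N -> s != 0 -> r != 0 ->
    p = s%:~R / r%:~R -> is_gen_power_sum p f ->
  reduced_equation f (zariski_closure (power_sum_torus_image s r)).
Proof.
move=> n0 s0 r0 pE [s1 [r1 [r10]]].
have rat0 (k : int) : (k%:~R == 0 :> rat) = (k == 0) by rewrite intr_eq0.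
rewrite pE => /eqP; rewrite eqr_div ?rat0 // -!intrM => /eqP/intr_inj E.
have s10 : s1 != 0.
  by apply/eqP => s10; move/eqP: E; rewrite s10 mul0r mulf_eq0 (negbTE s0) (negbTE r10).
rewrite /is_power_sum_power (negbTE s10) (power_sum_torus_image_eq s0 s10 E).
rewrite /coord_power; case: ifPn => r1gt; last by rewrite torus_coord_image.
case=> -[d hf] sqf fE; split=> //; first by exists d.
have Tf y : power_sum_torus_image s1 r1 y -> proj_zeros f y.
  rewrite fE -torus_coord_image // => -[x [c [[xs _] c0 ->]]].
  by exists x, c.
apply/seteqP; split; last by apply: (sub_zariski_closure hf) => y /Tf [].
move=> y yf; split; first by case: yf.
move=> e g hg gT; move: yf; rewrite fE => -[x [c [[x0 xs] c0 ->]]].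
(* For positive [r1] no closure was taken in [coord_power]. Composing [g] with the power map gives a
   polynomial vanishing on the torus part of the power sum, hence on all of it. *)
have -> : g.@[(c *: (\row_i x 0 i ^ r1)) 0] =
    c ^+ e * (mmap (@mpolyC _ F) (fun i => 'X_i ^+ `|r1|) g).@[x 0].
  rewrite meval_mmap -dhomog_scale //; apply: meval_eq => i.
  by rewrite !mxE rmorphXn /= mevalXU exprnP gez0_abs // Order.POrderTheory.ltW.
rewrite (power_sum_vanish n0 s10 _ xs) ?mulr0 // => z Wz.
have := gT (1 *: \row_i (z i ^ r1)); rewrite meval_mmap => <-.
  apply: meval_eq => i; rewrite !mxE mul1r rmorphXn /= mevalXU exprnP gez0_abs //.
  exact: Order.POrderTheory.ltW.
by exists z, 1; rewrite oner_neq0.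
Qed.

End ProjectiveSpace.
End PowerSumHypersurfaces.

(** * Duality *)

Section Duality.
Local Open Scope classical_set_scope.
Variables (F : numClosedFieldType) (n : nat).
Implicit Types (f g fp fq : {mpoly F[n.+1]}).

Lemma dhomog_mmap (k d e : nat) g (h : 'I_n.+1 -> {mpoly F[k]}) :
    g \is d.-homog -> (forall i, h i \is e.-homog) ->
  mmap (@mpolyC k F) h g \is (e * d)%N.-homog.
Proof.
move=> /dhomogP hg hh; rewrite /mmap big_seq; apply: rpred_sum => m /hg <-.
rewrite mul_mpolyC; apply: dhomogZ; rewrite /mmap1 /= mdegE.
elim/big_rec2: _ => [|i p q _ IH]; first by rewrite muln0 dhomog1.
by rewrite mulnDr; apply: dhomogM => //; apply: dhomogMn.
Qed.

Lemma dhomog_mderiv (d : nat) f i : f \is d.-homog -> f^`M(i) \is d.-1.-homog.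
Proof.
move=> /dhomogP hf; apply/dhomogP => m; rewrite mcoeff_msupp mcoeff_deriv => H.
have /hf <- : (m + U_(i))%MM \in msupp f.
  by rewrite mcoeff_msupp; apply: contraNneq H => ->; rewrite mul0rn.
by rewrite /= mdegD mdeg1 addn1.
Qed.

Lemma hyperplane_eq_tangent f (x a : 'rV[F]_n.+1) :
    a != 0 -> gradient f x != 0 -> hyperplane a = proj_tangent_space f x ->
  exists2 c, c != 0 & a = c *: gradient f x.
Proof.
have tangentE (y : 'rV[F]_n.+1) :
    y != 0 -> \sum_i gradient f x 0 i * y 0 i = 0 -> proj_tangent_space f x y.
  by move=> y0 sy; split=> //; rewrite -[RHS]sy; apply: eq_bigr => i _; rewrite mxE.
move: (gradient f x) tangentE => b tangentE a0 b0 E.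
have [j bj] : exists j, b 0 j != 0.
  apply: contrapT => H; case/eqP: b0; apply/rowP => j; rewrite [RHS]mxE.
  by apply/eqP; apply: contrapT => /negP bj; apply: H; exists j.
have Eab i : a 0 i = a 0 j / b 0 j * b 0 i.
  have [->|ne_ij] := eqVneq i j; first by rewrite divfK.
  (* This vector lies in the hyperplane of [b], hence in that of [a], which forces the [i]-th and
     [j]-th coordinates of [a] and [b] to be proportional. *)
  pose y : 'rV[F]_n.+1 := b 0 j *: delta_mx 0 i - b 0 i *: delta_mx 0 j.
  have sumy (u : 'I_n.+1 -> F) : \sum_l u l * y 0 l = u i * b 0 j - u j * b 0 i.
    rewrite (bigD1 i) //= (bigD1 j) 1?eq_sym //= big1 ?addr0 => [|l /andP[li lj]].
      rewrite !mxE !eqxx (eq_sym j) (negbTE ne_ij) /=.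
      by rewrite !mulr1 !mulr0 subr0 sub0r mulrN.
    by rewrite !mxE (negbTE li) (negbTE lj) /= !mulr0 subr0 mulr0.
  have y0 : y != 0.
    apply/eqP => /rowP /(_ i) /eqP; rewrite !mxE !eqxx (negbTE ne_ij) /=.
    by rewrite mulr1 mulr0 subr0 (negbTE bj).
  have : proj_tangent_space f x y.
    by apply: tangentE => //; rewrite sumy mulrC subrr.
  rewrite -E => -[_]; rewrite sumy => /eqP; rewrite subr_eq0 => /eqP H.
  by apply: (mulIf bj); rewrite H; field.
have aE : a = (a 0 j / b 0 j) *: b by apply/rowP => i; rewrite Eab mxE.
by exists (a 0 j / b 0 j) => //; apply: contraNneq a0 => c0; rewrite aE c0 scale0r.
Qed.

(** If the leading coefficient vanished for negative [s], so would the constant one, a product of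
    nonzero coordinates. This makes [power_sum_dense] applicable at torus points. *)
Lemma psum_lead_neq0 s (z : 'I_n.+1 -> F) : torus_power_sum s z ->
  psum_lead s (fun i : 'I_n => z (widen_ord (leqnSn n) i)) != 0.
Proof.
move=> /torus_power_sum_split [u0 y0]; case: s => m /=; first by rewrite oner_neq0.
move=> /eqP; apply: contraTneq => ->; rewrite mul0r add0r.
by apply/prodf_neq0 => l _; rewrite expf_neq0 ?u0.
Qed.

(* Negative powers of the coordinates are polynomial up to the common factor
   [\prod_j z j ^ e]. *)
Lemma coord_power_mpoly (e : int) d g : g \is d.-homog ->
  exists G : {mpoly F[n.+1]}, forall z : 'I_n.+1 -> F, torus_point z ->
    (G.@[z] == 0) = (g.@[fun i => z i ^ e] == 0).
Proof.
move=> hg; case: e => m.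
  exists (mmap (@mpolyC _ F) (fun i => 'X_i ^+ m) g) => z _.
  rewrite meval_mmap; congr (_ == 0); apply: meval_eq => i.
  by rewrite rmorphXn /= mevalXU.
exists (mmap (@mpolyC _ F) (fun i => \prod_(l | l != i) 'X_l ^+ m.+1) g) => z z0.
rewrite meval_mmap; set P := \prod_i z i ^+ m.+1.
have P0 : P != 0 by apply/prodf_neq0 => i _; rewrite expf_neq0.
have -> : g.@[fun i => (\prod_(l | l != i) 'X_l ^+ m.+1).@[z]]
        = P ^+ d * g.@[fun i => z i ^ Negz m].
  rewrite -dhomog_scale //; apply: meval_eq => i.
  have -> : P = z i ^+ m.+1 * \prod_(l | l != i) z l ^+ m.+1 by rewrite /P (bigD1 i).
  rewrite rmorph_prod mulrAC NegzE -exprnN mulfV ?expf_neq0 // mul1r.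
  by apply: eq_bigr => l _; rewrite rmorphXn /= mevalXU.
by rewrite mulf_eq0 expf_eq0 (negbTE P0) andbF.
Qed.

Lemma torus_image_row s r (z : 'I_n.+1 -> F) :
  torus_power_sum s z -> power_sum_torus_image s r (\row_i z i ^ r).
Proof. by move=> Wz; exists z, 1; rewrite scale1r oner_neq0. Qed.

Lemma torus_image_sub_closure s r f (z : 'I_n.+1 -> F) :
    reduced_equation f (zariski_closure (power_sum_torus_image s r)) ->
  torus_power_sum s z -> f.@[fun i => z i ^ r] = 0.
Proof.
move=> [_ _ fE] Wz; have Tz := torus_image_row r Wz.
have : proj_zeros f (\row_i z i ^ r).
  by rewrite fE; split=> [|d g _]; [exact: power_sum_torus_image_neq0 Tz | apply].
by case=> _ <-; apply: meval_eq => i; rewrite mxE.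
Qed.

Lemma dual_power_sum_sub (s : int) (r : nat) fp fq :
    s != 0 -> (0 < r)%N ->
    reduced_equation fp (zariski_closure (power_sum_torus_image s r%:Z)) ->
    reduced_equation fq (zariski_closure (power_sum_torus_image s (s - r%:Z))) ->
  dual_variety (proj_zeros fp) `<=` proj_zeros fq.
Proof.
move=> s0 r0 [_ _ fpE] hfq; have [[d hq] _ _] := hfq.
apply: (sub_zariski_closure hq) => y [y0 [f [x [[[e hf] sqf fE] [fx gx0] Hy]]]].
have [c c0 ->] := hyperplane_eq_tangent y0 gx0 Hy.
(* The dual variety allows any reduced equation [f]; having the zeros of [fp], it vanishes at the
   same powers of torus points. *)
have fW z : torus_power_sum s z -> f.@[fun i => z i ^+ r] = 0.
  move=> Wz; apply: (@torus_image_sub_closure s r%:Z f z _ Wz).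
  by split; rewrite ?fE ?fpE //; exists e.
pose H := mmap (@mpolyC _ F) (fun i => f^`M(i)) fq.
have hH : H \is (e.-1 * d)%N.-homog by apply: dhomog_mmap => // i; apply: dhomog_mderiv.
have Hx : H.@[x 0] = 0.
  move: fx; rewrite fE fpE => -[x0]; apply; first exact: hH.
  move=> _ [z [c' [Wz c'0 ->]]].
  have -> : H.@[(c' *: (\row_i z i ^ r%:Z)) 0] = c' ^+ (e.-1 * d) * H.@[fun i => z i ^+ r].
    by rewrite -dhomog_scale //; apply: meval_eq => i; rewrite !mxE.
  have [h Hh] := power_sum_tangent s0 r0 fW Wz.
  rewrite meval_mmap (meval_eq _ Hh).
  by rewrite (dhomog_scale _ _ hq) (torus_image_sub_closure hfq Wz) !mulr0.
have -> : fq.@[(c *: gradient f x) 0] = c ^+ d * H.@[x 0].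
  by rewrite meval_mmap -dhomog_scale //; apply: meval_eq => i; rewrite !mxE.
by rewrite Hx mulr0.
Qed.

Lemma power_sum_sub_dual (s : int) (r : nat) fp :
    (0 < n)%N -> s != 0 -> (0 < r)%N ->
    reduced_equation fp (zariski_closure (power_sum_torus_image s r%:Z)) ->
  zariski_closure (power_sum_torus_image s (s - r%:Z)) `<=` dual_variety (proj_zeros fp).
Proof.
move=> n0 s0 r0 hfp; have [hp sqf fpE] := hfp.
have fp0 : fp != 0.
  by apply/eqP => E; have := sqf 0 0; rewrite E mulr0 unitr0 => /(_ erefl).
have [c c0 Hc] := squarefree_smooth (@pchar_num F) sqf fp0.
have fW z : torus_power_sum s z -> fp.@[fun i => z i ^+ r] = 0.
  exact: (@torus_image_sub_closure s r%:Z fp z hfp).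
move=> x [x0 Hx]; split=> // d g hg gS; apply: Hx (hg) _ => _ [z [b [Wz b0 ->]]].
have -> : g.@[(b *: (\row_i z i ^ (s - r%:Z))) 0] = b ^+ d * g.@[fun i => z i ^ (s - r%:Z)].
  by rewrite -dhomog_scale //; apply: meval_eq => i; rewrite !mxE.
suff -> : g.@[fun i => z i ^ (s - r%:Z)] = 0 by rewrite mulr0.
(* The exponent [s - r] may be negative, whereas the density argument needs a polynomial in [z]. *)
have [G HG] := coord_power_mpoly (s - r%:Z) hg.
have [z0 _] := Wz; apply/eqP; rewrite -HG //; apply/eqP.
have [_ _ Ez] := (torus_power_sum_split s z).1 Wz.
apply: (power_sum_dense n0 s0 r0 c0) (psum_lead_neq0 Wz) Ez => {b b0 z0 Wz} {}z Wz cz.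
have [z0 _] := Wz; apply/eqP; rewrite HG //.
have [h Hh] := power_sum_tangent s0 r0 fW Wz.
(* The last partial derivative is nonzero here by the choice of [c], and it is a multiple of [h]. *)
have h0 : h != 0.
  have := Hc _ (fW _ Wz) cz; rewrite Hh.
  by apply: contraNneq => ->; rewrite mul0r.
pose x1 : 'rV[F]_n.+1 := \row_i z i ^ r%:Z.
have x1E : x1 0 =1 (fun i => z i ^+ r) by move=> i; rewrite mxE.
have gradE i : gradient fp x1 0 i = h * z i ^ (s - r%:Z).
  by rewrite mxE (meval_eq _ x1E) Hh.
have grad0 : gradient fp x1 != 0.
  apply/eqP => /rowP /(_ ord0) /eqP; rewrite gradE mxE mulf_eq0 (negbTE h0) /=.
  by rewrite expfz_eq0 (negbTE (z0 _)) andbF.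
have : g.@[gradient fp x1 0] = 0.
  apply: gS; split=> //; exists fp, x1; split=> //.
    split=> //; split; last by rewrite (meval_eq _ x1E) fW.
    exact: power_sum_torus_image_neq0 (torus_image_row _ Wz).
  apply/seteqP; split=> y [y0 Ey]; split=> //; rewrite -[RHS]Ey; apply: eq_bigr => i _;
    by rewrite mxE.
rewrite (meval_eq _ gradE) (dhomog_scale _ _ hg) => /eqP.
by rewrite mulf_eq0 expf_eq0 (negbTE h0) andbF.
Qed.

Lemma dual_gen_power_sum (p q : rat) fp fq :
    (0 < n)%N -> p != 0 -> q != 0 -> p^-1 + q^-1 = 1 ->
    is_gen_power_sum p fp -> is_gen_power_sum q fq ->
  dual_variety (proj_zeros fp) = proj_zeros fq.
Proof.
move=> n0 p0 q0 pq hfp hfq; pose s := numq p.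
have s0 : s != 0 by rewrite numq_eq0.
have [r r0 pE] : exists2 r : nat, (0 < r)%N & p = s%:~R / r%:Z%:~R.
  exists `|denq p|%N; first by rewrite absz_gt0 denq_eq0.
  by rewrite gez0_abs ?divq_num_den // Order.POrderTheory.ltW.
have sQ : s%:~R != 0 :> rat by rewrite intr_eq0.
(* With [p = s / r], the relation gives [1 / q = 1 - r / s]; as [1 / q] is nonzero, so is
   [s - r]. *)
have qE' : q^-1 = (s - r%:Z)%:~R / s%:~R.
  have -> : q^-1 = 1 - p^-1 by rewrite -pq addrAC subrr add0r.
  by rewrite pE invf_div rmorphB /= mulrBl divff.
have e0 : s - r%:Z != 0.
  by apply: contraNneq q0 => E; rewrite -invr_eq0 qE' E mul0r.
have qE : q = s%:~R / (s - r%:Z)%:~R by rewrite -[q]invrK qE' invf_div.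
have rz0 : r%:Z != 0 by rewrite eqz_nat -lt0n.
have rp := gen_power_sumP n0 s0 rz0 pE hfp.
have rq := gen_power_sumP n0 s0 e0 qE hfq.
apply/seteqP; split; first exact: dual_power_sum_sub rp rq.
by have [_ _ ->] := rq; apply: power_sum_sub_dual.
Qed.

End Duality.

Theorem proposition3p10 (R : realType) (n : nat) (hn : (1 <= n)%N)
    (p q : rat) (hp : p != 0) (hq : q != 0) (hpq : p^-1 + q^-1 = 1)
    (fp fq : {mpoly (complex R)[n.+1]})
    (hfp : is_gen_power_sum p fp) (hfq : is_gen_power_sum q fq) :
  dual_variety (proj_zeros fp) = proj_zeros fq.
Proof. exact: (dual_gen_power_sum hn hp hq hpq hfp hfq). Qed.
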